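(* Let $p$ be an odd prime and let $g\in G$, $g\neq 1$, be represented by a matrix $\begin{bmatrix}a&b\\c&d\end{bmatrix}\in\mathrm{GL}_2(\mathbb{Z})$ with $N:=\max(|a|,|b|,|c|,|d|)\le (p/128)^{1/8}$. Then $g$ has at most $1024\,p\,N^8$ fixed points on $M(\mathbb{F}_p)$.
   Context: $M(\mathbb{F}_p)$ denotes the set of triples $(x,y,z)\in\mathbb{F}_p^3\setminus\{(0,0,0)\}$ satisfying $x^2+y^2+z^2=xyz$. The Markoff moves are the maps $m_1(x,y,z)=(yz-x,y,z)$, $m_2(x,y,z)=(x,xz-y,z)$, $m_3(x,y,z)=(x,y,xy-z)$ on $M(\mathbb{F}_p)$. Let $G=\mathbb{Z}/2*\mathbb{Z}/2*\mathbb{Z}/2$ be the free product with generators $m_1,m_2,m_3$; it acts on $M(\mathbb{F}_p)$ with $m_i$ acting by the $i$-th Markoff move. There is an injective homomorphism $G\to\mathrm{PGL}_2(\mathbb{Z})$ sending $m_1,m_2,m_3$ to the classes of $\begin{bmatrix}1&0\\2&-1\end{bmatrix}$, $\begin{bmatrix}-1&2\\0&1\end{bmatrix}$, $\begin{bmatrix}-1&0\\0&1\end{bmatrix}$ respectively. An element $g\in G$ is said to be represented by a matrix in $\mathrm{GL}_2(\mathbb{Z})$ if that matrix lies in the class that is the image of $g$ (the matrix is determined up to sign). *)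

(* Defs.v *)
From HB Require Import structures.
From mathcomp Require Import all_boot all_order all_algebra.
Set Implicit Arguments. Unset Strict Implicit. Unset Printing Implicit Defensive.
Import Order.TTheory GRing.Theory Num.Theory.
Local Open Scope ring_scope.

(* Elements of G = Z/2 * Z/2 * Z/2 are represented by reduced words over the
   generators m_1, m_2, m_3, indexed by 'I_3 (index 0 <-> m_1, 1 <-> m_2,
   2 <-> m_3).  A word is reduced iff no two consecutive letters coincide;
   reduced words are in bijection with G, and the identity is the empty word. *)
Definition reduced_word (w : seq 'I_3) : bool :=
  path (fun i j => i != j) (head ord0 w) (behead w).

Definition markoff (p : nat) (t : 'F_p * 'F_p * 'F_p) : bool :=
  let: (x, y, z) := t in
  (t != (0, 0, 0)) && (x ^+ 2 + y ^+ 2 + z ^+ 2 == x * y * z).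

Definition markoff_move (p : nat) (i : 'I_3) (t : 'F_p * 'F_p * 'F_p)
  : 'F_p * 'F_p * 'F_p :=
  let: (x, y, z) := t in
  match val i with
  | 0%N => (y * z - x, y, z)
  | 1%N => (x, x * z - y, z)
  | _ => (x, y, x * y - z)
  end.

Definition word_act (p : nat) (w : seq 'I_3) (t : 'F_p * 'F_p * 'F_p) :=
  foldr (@markoff_move p) t w.

(* Matrices in GL_2(Z) lifting the images of the generators in PGL_2(Z). *)
Definition mx22 (a b c d : int) : 'M[int]_2 :=
  \matrix_(k < 2, l < 2)
    (if k == 0 :> nat then (if l == 0 :> nat then a else b)
     else (if l == 0 :> nat then c else d)).

Definition gen_mx (i : 'I_3) : 'M[int]_2 :=
  match val i with
  | 0%N => mx22 1 0 2 (-1)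
  | 1%N => mx22 (-1) 2 0 1
  | _ => mx22 (-1) 0 0 1
  end.

Definition word_mx (w : seq 'I_3) : 'M[int]_2 :=
  foldr (fun i A => gen_mx i *m A) 1%:M w.

(* g is represented by A iff A lies in the class of the image of g in
   PGL_2(Z) = GL_2(Z)/{+-1}. *)
Definition represented_by (w : seq 'I_3) (A : 'M[int]_2) : Prop :=
  word_mx w = A \/ word_mx w = - A.

Definition mx_height (A : 'M[int]_2) : nat :=
  \max_(k < 2) \max_(l < 2) `|A k l|%N.

Definition fixed_points (p : nat) (w : seq 'I_3) : {set 'F_p * 'F_p * 'F_p} :=
  [set t | markoff t && (word_act w t == t)].

(* Main.v *)
(** Let j be the last letter of w, the first move to be applied.  Fix the value
    x of the j-th coordinate and write x = u + 1/u over an algebraic closure of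
    F_p.  If x <> 0, 2, -2, the conic cut out on the Markoff surface is
    parametrised by s |-> (s + c/s, u s + c/(u s)) with
    c = (x / (u - 1/u))^2, so the coordinates of w . t become Laurent
    polynomials in s.  Since w is reduced, every move replaces a coordinate by
    the product of two others whose degrees add up to more than its own degree;
    hence leading terms multiply, never cancel or vanish modulo p, and degrees
    grow strictly.  The coordinate moved last gives a nontrivial equation
    in s of degree at most 8N, as its pole order is a linear form in the
    entries of the matrix of w.  The fibres over x = 0, 2, -2 have
    at most 2p points each, so there are at most 8Np + 6p fixed points. *)
Require Import Defs.
From HB Require Import structures.
From mathcomp Require Import all_boot all_order all_algebra.
From mathcomp Require Import closed_field zify ring.
Set Implicit Arguments. Unset Strict Implicit. Unset Printing Implicit Defensive.
Import GRing.Theory.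
Local Open Scope ring_scope.

(** * Counting by fibres and by roots of polynomials *)

Lemma card_le_fibers (T U : finType) (S : {set T}) (f : T -> U) (n : U -> nat) :
  (forall u, #|[set t in S | f t == u]| <= n u)%N -> (#|S| <= \sum_u n u)%N.
Proof.
move=> le_fib; rewrite -sum1_card (partition_big f predT) //=.
apply: leq_sum => u _; apply: leq_trans (le_fib u).
by rewrite -sum1_card; apply: eq_leq; apply: eq_bigl => t; rewrite inE.
Qed.

Lemma card_lt_size_poly (T : finType) (K : idomainType) (S : {set T})
    (g : T -> K) (q : {poly K}) :
  q != 0 -> {in S &, injective g} -> (forall t, t \in S -> root q (g t)) ->
  (#|S| < size q)%N.
Proof.
move=> q0 g_inj rt; rewrite cardE -(size_map g); apply: max_poly_roots => //.
  by apply/allP=> x /mapP[t]; rewrite mem_enum => /rt rtt ->.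
rewrite map_inj_in_uniq ?enum_uniq // => t u.
by rewrite !mem_enum; apply: g_inj.
Qed.

Lemma ord3P (i : 'I_3) : [\/ i = 0, i = 1 | i = 1 + 1].
Proof.
by case: i => [[|[|[|//]]]] lt_i;
  [constructor 1 | constructor 2 | constructor 3]; apply/val_inj.
Qed.

(** * Markoff moves in indexed coordinates *)

Section Words.
Variable R : comNzRingType.

Definition coord (t : R * R * R) (k : 'I_3) : R :=
  match val k with 0%N => t.1.1 | 1%N => t.1.2 | _ => t.2 end.

(** Addition in ['I_3] is modulo 3, so [i + 1] and [i + 1 + 1] are the two other indices and the
    three moves share one formula. *)
Definition coord_move (i : 'I_3) (x : 'I_3 -> R) (k : 'I_3) : R :=
  if k == i then x (i + 1) * x (i + 1 + 1) - x i else x k.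

Definition coord_act (w : seq 'I_3) (x : 'I_3 -> R) : 'I_3 -> R :=
  foldr coord_move x w.

Lemma coord_inj (j : 'I_3) (t u : R * R * R) :
  coord t j = coord u j -> coord t (j + 1) = coord u (j + 1) ->
  coord t (j + 1 + 1) = coord u (j + 1 + 1) -> t = u.
Proof.
by case: (ord3P j) t u => -> [[x y] z] [[x' y'] z']; rewrite /coord /= => -> -> ->.
Qed.

Lemma eq_coord_act w x y : x =1 y -> coord_act w x =1 coord_act w y.
Proof.
by move=> exy; elim: w => //= i w IHw k; rewrite /coord_move !IHw.
Qed.

End Words.

Lemma coord_markoff p (t : 'F_p * 'F_p * 'F_p) (j : 'I_3) : markoff t ->
  coord t j ^+ 2 + coord t (j + 1) ^+ 2 + coord t (j + 1 + 1) ^+ 2 =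
  coord t j * coord t (j + 1) * coord t (j + 1 + 1).
Proof.
case: t => [[x y] z] /andP[_ /eqP e].
have e' : x ^+ 2 + y ^+ 2 + z ^+ 2 - x * y * z = 0 by rewrite e subrr.
by apply/eqP; rewrite -subr_eq0 -{1}e'; case: (ord3P j) => ->;
  rewrite /coord /=; apply/eqP; ring.
Qed.

Lemma coord_word_act p (K : fieldType) (iota : {rmorphism 'F_p -> K}) w t k :
  iota (coord (word_act w t) k) = coord_act w (fun l => iota (coord t l)) k.
Proof.
elim: w k => //= i w IHw k; rewrite /coord_move -!IHw.
case: (word_act w t) => [[x y] z].
by case: (ord3P i) => ->; case: (ord3P k) => ->; rewrite /coord /= ?rmorphB ?rmorphM //=;
  rewrite mulrC.
Qed.

(** * Growth of the degrees along a reduced word *)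

(* Identifying x, y, z with the traces of A, B, AB for a pair (A, B) in SL_2
   with [tr [A, B] = -2], each coordinate of [w . t] is the trace of a primitive
   word in A, B.  Its degree in the parameter s of the fibre over coordinate j
   is an intersection number of homology classes: it is read off from the
   vector v = [word_mx w] * [slope_base j], where [slope_base j] is (1, 0),
   (0, 1) or (1, 1), as |v_2|, |v_1| or |v_1 - v_2|. *)
Definition slope_degree (v : int * int) (k : 'I_3) : nat :=
  match val k with
  | 0%N => `|v.2|%N
  | 1%N => `|v.1|%N
  | _ => `|v.1 - v.2|%N
  end.

Definition slope_base (j : 'I_3) : int * int :=
  match val j with 0%N => (1, 0) | 1%N => (0, 1) | _ => (1, 1) end.

Definition slope_move (i : 'I_3) (v : int * int) : int * int :=
  match val i with
  | 0%N => (v.1, 2 * v.1 - v.2)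
  | 1%N => (2 * v.2 - v.1, v.2)
  | _ => (- v.1, v.2)
  end.

Definition slope_act (w : seq 'I_3) (v : int * int) : int * int :=
  foldr slope_move v w.

Definition dominant (i : 'I_3) (v : int * int) : Prop :=
  (slope_degree v i = slope_degree v (i + 1)%R + slope_degree v (i + 1 + 1)%R)%N /\
  forall k, (0 < slope_degree v k)%N.

Lemma slope_degree_move i k v : k != i ->
  slope_degree (slope_move i v) k = slope_degree v k.
Proof.
by case: (ord3P i) => ->; case: (ord3P k) => -> //= _;
  rewrite /slope_degree /slope_move /=; lia.
Qed.

(** Let l be the third index. As i dominates, the degree at k is the difference of those at i and l;
    move k replaces this difference by their sum. The strict inequality later protects leading terms
    from cancellation. *)
Lemma dominant_move i k v : dominant i v -> k != i ->
  dominant k (slope_move k v) /\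
  (slope_degree v k < slope_degree v (k + 1)%R + slope_degree v (k + 1 + 1)%R)%N.
Proof.
case=> + pos; move: (pos 0) (pos 1) (pos (1 + 1)).
case: (ord3P i) => ->; case: (ord3P k) => -> //=;
  rewrite /dominant /slope_degree /slope_move /= => pos0 pos1 pos2 di _;
  (split; [split; [lia | move=> l; case: (ord3P l) => -> /=; lia] | lia]).
Qed.

Lemma dominant_base j : dominant j (slope_move j (slope_base j)).
Proof. by case: (ord3P j) => ->; split => // k; case: (ord3P k) => ->. Qed.

Lemma dominant_act i w : path (fun a b : 'I_3 => a != b) i w ->
  dominant i (slope_act (i :: w) (slope_base (last i w))).
Proof.
elim: w i => [|k w IHw] i /=; first by move=> _; apply: dominant_base.
by case/andP=> ik /IHw dk; case: (dominant_move dk ik).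
Qed.

Lemma word_mx_slope w (v : int * int) :
  slope_act w v = (word_mx w ord0 ord0 * v.1 + word_mx w ord0 ord_max * v.2,
                   word_mx w ord_max ord0 * v.1 + word_mx w ord_max ord_max * v.2).
Proof.
elim: w => [|i w IHw] /=.
  by rewrite !mxE /=; case: v => a b /=; congr (_, _); ring.
rewrite IHw !mxE !big_ord_recl !big_ord0 /=.
have -> : lift ord0 ord0 = ord_max :> 'I_2 by apply/val_inj.
by case: (ord3P i) => ->; rewrite /slope_move /gen_mx /mx22 !mxE /=;
  congr (_, _); ring.
Qed.

Lemma mx_height_ge (A : 'M[int]_2) k l : (`|A k l| <= mx_height A)%N.
Proof.
apply: leq_trans (leq_bigmax (F := fun k => (\max_(l < 2) `|A k l|)%N) k).
exact: (leq_bigmax (F := fun l => `|A k l|%N)).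
Qed.

Lemma mx_heightN (A : 'M[int]_2) : mx_height (- A) = mx_height A.
Proof.
by apply: eq_bigr => k _; apply: eq_bigr => l _; rewrite mxE abszN.
Qed.

(** The entries of [slope_base j] are 0 or 1, so those of the image vector are at most twice the
    height; [|v_1 - v_2|] costs another factor 2. *)
Lemma slope_degree_le w j k :
  (slope_degree (slope_act w (slope_base j)) k <= 4 * mx_height (word_mx w))%N.
Proof.
rewrite word_mx_slope.
have:= mx_height_ge (word_mx w) ord0 ord0.
have:= mx_height_ge (word_mx w) ord0 ord_max.
have:= mx_height_ge (word_mx w) ord_max ord0.
have:= mx_height_ge (word_mx w) ord_max ord_max.
by case: (ord3P j) => ->; case: (ord3P k) => ->;
  rewrite /slope_degree /slope_base /=; lia.
Qed.

(** * Laurent polynomials of exact degree *)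

Section LaurentDegree.
Variable K : closedFieldType.

(* On nonzero arguments [T s] is a Laurent polynomial in [s] whose pole order
   at infinity is exactly [d], and at most [d] at the origin. *)
Definition laurent_degree (d : nat) (T : K -> K) : Prop :=
  exists2 f : {poly K}, size f = d.*2.+1 &
    forall s, s != 0 -> f.[s] = s ^+ d * T s.

(** The shift brings both terms to the common denominator [s ^+ d]. The subtracted one has degree d
    + e < 2d, so the leading term of [f] survives. *)
Lemma size_sub_shift (f g : {poly K}) (d e : nat) : (e < d)%N ->
  size f = d.*2.+1 -> size g = e.*2.+1 ->
  size (f - g * 'X^(d - e)) = d.*2.+1.
Proof.
move=> lt_ed sf sg.
have g0 : g != 0 by rewrite -size_poly_eq0 sg.
rewrite size_polyDl ?sf // size_polyN size_mulXn // sg; lia.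
Qed.

Lemma laurent_degree_move d1 d2 d3 (T1 T2 T3 : K -> K) :
  laurent_degree d1 T1 -> laurent_degree d2 T2 -> laurent_degree d3 T3 ->
  (d3 < d1 + d2)%N ->
  laurent_degree (d1 + d2) (fun s => T1 s * T2 s - T3 s).
Proof.
move=> [f sf ef] [g sg eg] [h sh eh] lt_d.
exists (f * g - h * 'X^(d1 + d2 - d3)).
  apply: size_sub_shift => //.
  have f0 : f != 0 by rewrite -size_poly_eq0 sf.
  have g0 : g != 0 by rewrite -size_poly_eq0 sg.
  by rewrite size_mul // sf sg; lia.
move=> s s0; rewrite hornerD hornerN !hornerM hornerXn ef // eg // eh //.
have -> : s ^+ d3 * T3 s * s ^+ (d1 + d2 - d3) = s ^+ (d1 + d2) * T3 s.
  by rewrite mulrAC -exprD subnKC // ltnW.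
by rewrite exprD; ring.
Qed.

Lemma laurent_degree_act (T : K -> 'I_3 -> K) i w :
  path (fun a b : 'I_3 => a != b) i w ->
  (forall k, laurent_degree (slope_degree (slope_base (last i w)) k) (T^~ k)) ->
  forall k, laurent_degree (slope_degree (slope_act (i :: w) (slope_base (last i w))) k)
                           (fun s => coord_act (i :: w) (T s) k).
Proof.
move=> red ldT; elim: w i red ldT => [|l w IHw] i.
  move=> _ /= ldT k; rewrite /coord_move; have [->|ki] := eqVneq k i; last first.
    by rewrite slope_degree_move.
  have [-> _] := dominant_base i; rewrite !slope_degree_move;
    try by case: (ord3P i) => ->.
  apply: laurent_degree_move => //.
  by case: (ord3P i) => ->.
rewrite [last _ _]/= [path _ _ _]/= => /andP[il red] ldT.
have IH := IHw l red ldT; have dl := dominant_act red.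
move=> k; change (laurent_degree
  (slope_degree (slope_move i (slope_act (l :: w) (slope_base (last l w)))) k)
  (fun s => coord_move i (coord_act (l :: w) (T s)) k)).
move: (slope_act _ _) IH dl => v IH dl.
have [[di _] lt_d] := dominant_move dl il.
rewrite /coord_move; have [->|ki] := eqVneq k i; last first.
  by rewrite slope_degree_move.
rewrite di !slope_degree_move; try by case: (ord3P i) => ->.
exact: laurent_degree_move.
Qed.

Lemma laurent_degree_root d e (T U : K -> K) :
  laurent_degree d T -> laurent_degree e U -> (e < d)%N ->
  exists2 q : {poly K}, size q = d.*2.+1 &
    forall s, s != 0 -> T s = U s -> root q s.
Proof.
move=> [f sf ef] [g sg eg] lt_ed; exists (f - g * 'X^(d - e)).
  exact: size_sub_shift.
move=> s s0 eTU; rewrite /root hornerD hornerN hornerM hornerXn ef // eg // eTU.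
by rewrite mulrAC -exprD subnKC ?subrr // ltnW.
Qed.

End LaurentDegree.

(** * Point counts on the fibres *)

(* The value of [s] solves the linear system y = s + r, z = u s + r / u; the
   Markoff equation then says exactly r s = c. *)
Lemma markoff_fiber_param (K : fieldType) (u y z : K) :
  let x := u + u^-1 in
  let c := (x / (u - u^-1)) ^+ 2 in
  let s := (u * z - y) / (u ^+ 2 - 1) in
  u != 0 -> u ^+ 2 != 1 -> x != 0 ->
  x ^+ 2 + y ^+ 2 + z ^+ 2 = x * y * z ->
  [/\ s != 0, y = s + c / s & z = u * s + c / (u * s)].
Proof.
move=> x c s u0; rewrite -subr_eq0 => u1 x0 e.
have v1 : u - u^-1 != 0.
  have -> : u - u^-1 = (u ^+ 2 - 1) / u by field.
  by rewrite mulf_neq0 ?invr_eq0.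
have c0 : c != 0 by rewrite expf_neq0 // mulf_neq0 ?invr_eq0.
have sr : s * (y - s) = c.
  apply/eqP; rewrite -subr_eq0; apply/eqP.
  have -> : s * (y - s) - c =
      (x * y * z - (x ^+ 2 + y ^+ 2 + z ^+ 2)) / (u - u^-1) ^+ 2.
    by rewrite /c /s /x; field; rewrite ?v1 ?u0 ?u1.
  by rewrite e subrr mul0r.
have s0 : s != 0 by apply: contra_neq c0 => s0; rewrite -sr s0 mul0r.
split=> //; rewrite -sr; first by field.
have -> : s * (y - s) / (u * s) = (y - s) / u by field; rewrite s0 u0.
by rewrite /s; field; rewrite u0.
Qed.

Lemma card_fixed_fiber p i w (x : 'F_p) (j := last i w) :
  path (fun a b : 'I_3 => a != b) i w -> x != 0 -> x ^+ 2 != 4 ->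
  (#|[set t in fixed_points p (i :: w) | coord t j == x]|
     <= (slope_degree (slope_act (i :: w) (slope_base j)) i).*2)%N.
Proof.
move=> red x0 x4; have [K [iota _]] := countable_algebraic_closure 'F_p.
have /closed_rootP[u] : size ('X^2 - (iota x) *: 'X + 1 : {poly K}) != 1.
  rewrite -addrA size_polyDl ?size_polyXn //.
  rewrite (leq_ltn_trans (size_polyD _ _)) // gtn_max size_polyN size_poly1.
  by rewrite (leq_ltn_trans (size_scale_leq _ _)) ?size_polyX.
rewrite /root !(hornerE, hornerXn) => /eqP eu.
have u0 : u != 0.
  by apply/eqP => u0; move/eqP: eu; rewrite u0 expr0n mulr0 subr0 add0r oner_eq0.
have ex : iota x = u + u^-1.
  apply: (mulIf u0); rewrite mulrDl mulVf //.
  by apply/eqP; rewrite -subr_eq0 -oppr_eq0 opprB -eu; apply/eqP; ring.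
have u1 : u ^+ 2 != 1.
  apply: contra_neq x4 => u1; apply: (fmorph_inj iota).
  have e : u^-1 = u by apply: (mulIf u0); rewrite mulVf // -expr2 u1.
  by rewrite rmorphXn /= ex e rmorph_nat -mulr2n exprMn_n u1.
have X0 : u + u^-1 != 0 by rewrite -ex fmorph_eq0.
pose c := ((u + u^-1) / (u - u^-1)) ^+ 2.
pose T s k : K := if k == j then iota x else
  if k == j + 1 then s + c / s else u * s + c / (u * s).
have j1 : (j + 1 == j) = false by case: (ord3P j) => ->.
have j2 : (j + 1 + 1 == j) = false by case: (ord3P j) => ->.
have j21 : (j + 1 + 1 == j + 1) = false by case: (ord3P j) => ->.
have ordP k : [\/ k = j, k = j + 1 | k = j + 1 + 1].
  by case: (ord3P j) => ->; case: (ord3P k) => ->;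
    (constructor 1; exact/val_inj) || (constructor 2; exact/val_inj)
    || (constructor 3; exact/val_inj).
have base0 : slope_degree (slope_base j) j = 0%N by case: (ord3P j) => ->.
have base1 : slope_degree (slope_base j) (j + 1) = 1%N by case: (ord3P j) => ->.
have base2 : slope_degree (slope_base j) (j + 1 + 1) = 1%N by case: (ord3P j) => ->.
have ldT k : laurent_degree (slope_degree (slope_base j) k) (T^~ k).
  rewrite /T; case: (ordP k) => ->; rewrite ?eqxx ?j1 ?j2 ?j21 ?base0 ?base1 ?base2.
  (* Exact degree 0 of the constant coordinate uses [x != 0]. *)
  - exists (iota x)%:P; first by rewrite size_polyC fmorph_eq0 x0.
    by move=> s _; rewrite hornerC mul1r.
  - exists ('X^2 + c%:P).
      by rewrite size_polyDl ?size_polyXn // size_polyC; case: (c != 0).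
    by move=> s s0; rewrite hornerD hornerXn hornerC; field.
  - exists (u *: 'X^2 + (c / u)%:P).
      have su : size (u *: 'X^2) = 3%N by rewrite size_scale // size_polyXn.
      by rewrite size_polyDl ?su // size_polyC; case: (_ != 0).
    by move=> s s0; rewrite hornerD hornerZ hornerXn hornerC; field; rewrite s0 u0.
have [di dpos] := dominant_act red; rewrite -/j in di dpos.
(* Coordinate [i] starts with degree at most 1 and ends with a sum of two positive degrees, so
   equating the two values is a nontrivial condition on s. *)
have lt_d : (slope_degree (slope_base j) i <
             slope_degree (slope_act (i :: w) (slope_base j)) i)%N.
  have := dpos (i + 1); have := dpos (i + 1 + 1).
  have : (slope_degree (slope_base j) i <= 1)%N.
    by case: (ordP i) => ->; rewrite ?base0 ?base1 ?base2.
  by rewrite di; lia.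
have [q sq rq] := laurent_degree_root (laurent_degree_act red ldT i) (ldT i) lt_d.
pose s (t : 'F_p * 'F_p * 'F_p) :=
  (u * iota (coord t (j + 1 + 1)) - iota (coord t (j + 1))) / (u ^+ 2 - 1).
have sP t : t \in [set t in fixed_points p (i :: w) | coord t j == x] ->
    s t != 0 /\ forall k, T (s t) k = iota (coord t k).
  rewrite !inE => /andP[/andP[mt _] /eqP tx].
  have := congr1 iota (coord_markoff j mt).
  rewrite tx !(rmorphD, rmorphM, rmorphXn) /= ex => e.
  have [s0 ey ez] := markoff_fiber_param u0 u1 X0 e.
  split=> // k; rewrite /T; case: (ordP k) => ->; rewrite ?eqxx ?j1 ?j2 ?j21.
  - by rewrite tx.
  - by rewrite [RHS]ey.
  - by rewrite [RHS]ez.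
rewrite -ltnS -sq; apply: (card_lt_size_poly (g := s)).
- by rewrite -size_poly_eq0 sq.
- move=> t t' /sP[_ et] /sP[_ et'] ess.
  by apply: (coord_inj (j := j)); apply: (fmorph_inj iota); rewrite -et -et' ess.
move=> t tS; have [s0 eT] := sP t tS; apply: rq => //.
rewrite (eq_coord_act _ eT) -coord_word_act eT.
by move: tS; rewrite !inE => /andP[/andP[_ /eqP->]].
Qed.

(** With two coordinates fixed, the Markoff equation is a monic quadratic in the third. *)
Lemma card_markoff_fiber p (j : 'I_3) (x : 'F_p) :
  (#|[set t | markoff t & coord t j == x]| <= #|'F_p| * 2)%N.
Proof.
rewrite -sum_nat_const; apply: (@card_le_fibers _ _ _ (fun t => coord t (j + 1))) => y.
pose q : {poly 'F_p} := 'X^2 - (x * y) *: 'X + (x ^+ 2 + y ^+ 2)%:P.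
have sq : size q = 3%N.
  rewrite /q -addrA size_polyDl ?size_polyXn //.
  rewrite (leq_ltn_trans (size_polyD _ _)) // gtn_max size_polyN size_polyC.
  rewrite (leq_ltn_trans (size_scale_leq _ _)) ?size_polyX //.
  by case: (_ != 0).
rewrite -ltnS -sq; apply: (card_lt_size_poly (g := fun t => coord t (j + 1 + 1))).
- by rewrite -size_poly_eq0 sq.
- move=> t t'; rewrite !inE.
  move=> /andP[/andP[_ /eqP tx] /eqP ty] /andP[/andP[_ /eqP tx'] /eqP ty'] e.
  by apply: (coord_inj (j := j)); rewrite ?tx ?ty ?tx' ?ty'.
move=> t; rewrite !inE => /andP[/andP[/coord_markoff-/(_ j) e /eqP tx] /eqP ty].
move: e; rewrite tx ty => e; rewrite /root /q !hornerD hornerN hornerZ hornerXn hornerX hornerC.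
by apply/eqP; move/eqP: e; rewrite -subr_eq0 => /eqP <-; ring.
Qed.

Theorem theorem6p1 (p : nat) (w : seq 'I_3) (A : 'M[int]_2) :
  prime p -> odd p ->
  reduced_word w -> w != [::] ->
  represented_by w A ->
  (128 * mx_height A ^ 8 <= p)%N ->
  (#|fixed_points p w| <= 1024 * p * mx_height A ^ 8)%N.
Proof.
move=> p_pr _ red w0 wA _.
have -> : mx_height A = mx_height (word_mx w).
  by case: wA => ->; rewrite ?mx_heightN.
case: w red w0 {wA} => // i w red _; rewrite /reduced_word /= in red.
set N := mx_height _; pose j := last i w.
pose d := slope_degree (slope_act (i :: w) (slope_base j)) i.
have dN : (d <= 4 * N)%N by apply: slope_degree_le.
have N0 : (0 < N)%N.
  by have [_ /(_ i)] := dominant_act red; rewrite -/j -/d; lia.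
pose bad : seq 'F_p := [:: 0; 2; - 2].
have fib (x : 'F_p) :
    (#|[set t in fixed_points p (i :: w) | coord t j == x]|
       <= d.*2 + (x \in bad) * (p * 2))%N.
  have [xbad|] := boolP (x \in bad).
    have := card_markoff_fiber j x; rewrite card_Fp // mul1n => le2p.
    apply: leq_trans (leq_addl _ _); apply: leq_trans le2p; apply: subset_leq_card.
    by apply/subsetP => t; rewrite !inE => /andP[/andP[-> _] ->].
  rewrite !inE !negb_or => /and3P[x0 x2 x2']; apply: leq_trans (leq_addr _ _).
  apply: card_fixed_fiber => //; apply/negP => /eqP x4.
  have : (x - 2) * (x + 2) == 0 by rewrite -subr_sqr x4; apply/eqP; ring.
  by rewrite mulf_eq0 subr_eq0 addr_eq0 (negbTE x2) (negbTE x2').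
have := card_le_fibers fib.
rewrite big_split /= sum_nat_const card_Fp // -big_distrl /= => le_sum.
have bad3 : (\sum_(x : 'F_p) (x \in bad) <= 3)%N.
  by rewrite -big_mkcond sum1_card; apply: card_size.
apply: leq_trans le_sum _.
have N8 : (N <= N ^ 8)%N by rewrite -{1}(expn1 N) leq_pexp2l.
(* Each of the p fibres contributes at most 2d <= 8N, the exceptional ones 2p more each; 8N + 6 <=
   1024 N^8 since N >= 1. *)
apply: (@leq_trans (p * (8 * N) + 3 * (p * 2))).
  by rewrite leq_add ?leq_mul //; lia.
by nia.
Qed.
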